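(* For any fixed real $\alpha\neq 0$ and $\epsilon>0$, the set $\chi_{\epsilon,\alpha}\cap(1,\frac{1}{2\epsilon}-1)$ is at most countable.
   Context: For real $x$, $\Vert x\Vert$ denotes the distance from $x$ to the nearest integer. For real $\alpha\neq 0$ and $\epsilon>0$, $\chi_{\epsilon,\alpha}$ denotes the set of all real $\zeta>1$ such that $\Vert\alpha\zeta^n\Vert\leq\epsilon$ for all integers $n\geq n_0$, for some integer $n_0=n_0(\alpha,\zeta,\epsilon)$. *)

(* Defs.v *)
From HB Require Import structures.
From mathcomp Require Import all_boot all_order all_algebra.
From mathcomp Require Import all_classical all_reals.

Set Implicit Arguments.
Unset Strict Implicit.
Unset Printing Implicit Defensive.

Import Order.TTheory GRing.Theory Num.Theory.

Local Open Scope classical_set_scope.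
Local Open Scope ring_scope.

(* The set of distances is nonempty and bounded below by 0, so [inf] is the
   true infimum; it is attained at the integer(s) nearest to x. *)
Definition dist_int (R : realType) (x : R) : R :=
  inf (range (fun k : int => `|x - k%:~R|)).

Definition chi (R : realType) (eps alpha : R) : set R :=
  [set zeta | 1 < zeta /\
    exists n0 : int, forall n : int, n0 <= n ->
      dist_int (alpha * zeta ^ n) <= eps].

(* Main.v *)
(** If [u_n] is the integer nearest to [alpha * zeta ^ n], then for [n] large
    it determines [u_(n+1)], without [zeta] being known.  Indeed [u_n] confines
    [alpha * zeta ^ n] to an interval of length [2 eps], hence
    [alpha * zeta ^ (n+1)] to one of length about [2 eps zeta (1 + 1/n)], hence
    [u_(n+1)] to one of length about [2 eps (1 + zeta + zeta/n)], which is
    eventually [< 1] precisely because [zeta < 1/(2 eps) - 1].  So [zeta] is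
    determined by a large enough rank [N] and the integer [u_N]. *)
Require Import Defs.
From HB Require Import structures.
From mathcomp Require Import all_boot all_order all_algebra.
From mathcomp Require Import all_classical all_reals.
From mathcomp Require Import ring lra zify.

Import Order.TTheory GRing.Theory Num.Theory.

Local Open Scope classical_set_scope.
Local Open Scope ring_scope.

(** Rounding [x + 1/2] down gives an integer within [1/2] of [x], while every other integer is at
    least [1/2] away. *)
Lemma dist_int_attained (R : realType) (x : R) :
  exists k : int, `|x - k%:~R| <= dist_int x.
Proof.
exists (Num.floor (x + 2^-1)); set k0 := Num.floor _.
have /andP[k0_le lt_k0] : k0%:~R <= x + 2^-1 < (k0 + 1)%:~R.
  by rewrite Num.Theory.floor_itv.
rewrite intrD in lt_k0.
apply: lb_le_inf; first by exists `|x - 0%:~R|, 0.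
move=> _ [k _ <-]; have [->//|/eqP k_neq] := eqVneq k k0.
have half_le : 2^-1 <= `|x - k%:~R|.
  have [k_gt|k_lt] : (k0 + 1 <= k)%R \/ (k + 1 <= k0)%R by lia.
  - have : (k0 + 1)%:~R <= k%:~R :> R by rewrite ler_int.
    by rewrite intrD ler_normr; lra.
  - have : (k + 1)%:~R <= k0%:~R :> R by rewrite ler_int.
    by rewrite intrD ler_normr; lra.
by apply: le_trans half_le; rewrite ler_norml; lra.
Qed.

Lemma eq_of_dist_lt1 (p q : int) : `|p - q| < 1 -> p = q.
Proof. lia. Qed.

(** Each of the [n] terms of [(a ^+ n - b ^+ n) / (a - b)] is at least [b ^+ n.-1]; the extra factor
    [b] avoids the predecessor. *)
Lemma mulrn_sub_exp_le (R : realDomainType) (a b : R) (n : nat) :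
  0 <= b -> b <= a -> n%:R * (a - b) * b ^+ n <= b * (a ^+ n - b ^+ n).
Proof.
move=> b_ge0 b_le; elim: n => [|n IHn]; first by rewrite !expr0; lra.
have gap_ge0 : 0 <= a ^+ n - b ^+ n by rewrite subr_ge0 lerXn2r // nnegrE; lra.
have IHb := ler_wpM2l b_ge0 IHn.
(* This is the surplus in the induction step, from replacing [a] by [b] in
   [a * (a ^+ n - b ^+ n)]. *)
have step : 0 <= b * ((a - b) * (a ^+ n - b ^+ n)).
  by rewrite !mulr_ge0 // subr_ge0.
rewrite !exprS -natr1; nra.
Qed.

Section Determination.
Variables (R : realType) (alpha eps : R).

(** Write [a ^+ n.+1 - b ^+ n.+1] as [a * (a ^+ n - b ^+ n) + (a - b) * b ^+ n]; by
    [mulrn_sub_exp_le] the last term is at most [a / n] times the gap at [n]. *)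
Lemma exp_succ_gap_le (a b : R) (n : nat) :
  1 < b -> b <= a -> (0 < n)%N ->
  n%:R * `|alpha * (a ^+ n.+1 - b ^+ n.+1)|
    <= (n%:R + 1) * a * `|alpha * (a ^+ n - b ^+ n)|.
Proof.
move=> b_gt1 b_le n_gt0.
have b_ge0 : 0 <= b by lra.
have gap_ge0 m : 0 <= a ^+ m - b ^+ m.
  by rewrite subr_ge0 lerXn2r // nnegrE; lra.
rewrite !normrM !(ger0_norm (gap_ge0 _)) mulrCA [leRHS]mulrCA.
rewrite ler_wpM2l //.
have main := mulrn_sub_exp_le _ _ _ n b_ge0 b_le.
have b_a : b * (a ^+ n - b ^+ n) <= a * (a ^+ n - b ^+ n) by rewrite ler_wpM2r.
rewrite !exprS; nra.
Qed.

Definition near_int_from (N : nat) (zeta : R) : Prop :=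
  forall n, (N <= n)%N -> exists k : int, `|alpha * zeta ^+ n - k%:~R| <= eps.

(** The inequality [2 * eps * (1 + zeta + zeta / n) < 1], cleared of its denominator. *)
Definition late_rank (N : nat) (zeta : R) : Prop :=
  forall n, (N <= n)%N -> 2 * eps * (n%:R + (n%:R + 1) * zeta) < n%:R.

Lemma late_rank_exists (zeta : R) :
  0 < eps -> 1 < zeta -> zeta < 1 / (2 * eps) - 1 ->
  exists N, late_rank N zeta.
Proof.
move=> eps_gt0 zeta_gt1 zeta_lt.
have : 0 < 1 - 2 * eps * (1 + zeta).
  have : 1 + zeta < 1 / (2 * eps) by lra.
  by rewrite ltr_pdivlMr ?mulr_gt0 //; lra.
set d := 1 - _ => d_gt0.
(* With this [d], the inequality of [late_rank] reads [2 * eps * zeta < n * d]. *)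
exists (Num.truncn (2 * eps * zeta / d)).+1 => n n_ge.
have : 2 * eps * zeta / d < n%:R.
  by apply: lt_le_trans (truncnS_gt _) _; rewrite ler_nat.
by rewrite ltr_pdivrMr // /d; lra.
Qed.

(** The shared [k] bounds the gap at [n] by [2 * eps]. The growth factor [a * (1 + 1/n)] and the two
    errors at [n.+1] then give [|p - q| < 1]; since that factor involves the larger base, it is [a]
    that must be late. *)
Lemma near_int_succ (a b : R) (n : nat) (k p q : int) :
  1 < b -> b <= a -> (0 < n)%N -> late_rank n a ->
  `|alpha * a ^+ n - k%:~R| <= eps -> `|alpha * b ^+ n - k%:~R| <= eps ->
  `|alpha * a ^+ n.+1 - p%:~R| <= eps ->
  `|alpha * b ^+ n.+1 - q%:~R| <= eps -> p = q.
Proof.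
move=> b_gt1 b_le n_gt0 /(_ n (leqnn n)) late ka kb pa qb.
have n_gt0R : 0 < n%:R :> R by rewrite ltr0n.
have gap : `|alpha * (a ^+ n - b ^+ n)| <= 2 * eps.
  move: ka kb; rewrite !ler_norml mulrBr => /andP[? ?] /andP[? ?].
  by apply/andP; split; lra.
have step := exp_succ_gap_le _ _ _ b_gt1 b_le n_gt0.
have step' : n%:R * `|alpha * (a ^+ n.+1 - b ^+ n.+1)|
    <= (n%:R + 1) * a * (2 * eps).
  by apply: le_trans step _; rewrite ler_wpM2l // mulr_ge0; lra.
have pq : `|(p - q)%:~R : R| <= 2 * eps + `|alpha * (a ^+ n.+1 - b ^+ n.+1)|.
  have -> : (p - q)%:~R = alpha * (a ^+ n.+1 - b ^+ n.+1)
     - (alpha * a ^+ n.+1 - p%:~R) + (alpha * b ^+ n.+1 - q%:~R) :> R.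
    by rewrite intrB; ring.
  apply: le_trans (ler_normD _ _) _.
  have := ler_normB (alpha * (a ^+ n.+1 - b ^+ n.+1))
            (alpha * a ^+ n.+1 - p%:~R).
  lra.
have : `|(p - q)%:~R : R| < 1.
  by rewrite -(ltr_pM2l n_gt0R); nra.
by rewrite -intr_norm ltrz1 => /eq_of_dist_lt1.
Qed.

(** Sharing integers from rank [N] on keeps [alpha * (a ^+ n - b ^+ n)] bounded, whereas for [b < a]
    it grows at least linearly in [n]. *)
Lemma near_int_unique (a b : R) (N : nat) (k : int) :
  alpha != 0 -> 1 < b -> b <= a -> (0 < N)%N -> late_rank N a ->
  near_int_from N a -> near_int_from N b ->
  `|alpha * a ^+ N - k%:~R| <= eps -> `|alpha * b ^+ N - k%:~R| <= eps ->
  a = b.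
Proof.
move=> alpha_neq0 b_gt1 b_le N_gt0 late na nb ka kb.
have common m : exists l : int, `|alpha * a ^+ (N + m) - l%:~R| <= eps /\
    `|alpha * b ^+ (N + m) - l%:~R| <= eps.
  elim: m => [|m [l [la lb]]]; first by exists k; rewrite addn0.
  have leN : (N <= (N + m).+1)%N by rewrite leqW ?leq_addr.
  have [p pa] := na _ leN; have [q qb] := nb _ leN.
  exists p; rewrite addnS; split=> //.
  rewrite (near_int_succ a b (N + m) l p q) //; first by rewrite addn_gt0 N_gt0.
  by move=> n n_ge; apply: late; apply: leq_trans n_ge; rewrite leq_addr.
apply/eqP; rewrite eq_le b_le andbT leNgt; apply/negP => b_lt.
pose A := `|alpha|; have A_gt0 : 0 < A by rewrite normr_gt0.
have slope_gt0 : 0 < A * (a - b) by rewrite mulr_gt0 // subr_gt0.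
(* Chosen so that [n = N + m] violates [n * A * (a - b) <= b * A * (a ^+ n - b ^+ n) <= 2 * eps *
   b]. *)
pose m := (Num.truncn (2 * eps * b / (A * (a - b)))).+1.
have : 2 * eps * b / (A * (a - b)) < (N + m)%:R.
  by apply: lt_le_trans (truncnS_gt _) _; rewrite ler_nat leq_addl.
rewrite ltr_pdivrMr //; set n := (N + m)%N => big.
have [l [la lb]] := common m.
have gap : A * (a ^+ n - b ^+ n) <= 2 * eps.
  apply: (@le_trans _ _ `|alpha * (a ^+ n - b ^+ n)|).
    by rewrite normrM ler_wpM2l ?(ltW A_gt0) // ler_norm.
  move: la lb; rewrite -/n !ler_norml mulrBr => /andP[? ?] /andP[? ?].
  by apply/andP; split; lra.
have b_ge0 : 0 <= b by lra.
have main := mulrn_sub_exp_le _ _ _ n b_ge0 b_le.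
have bn_ge1 : 1 <= b ^+ n by rewrite exprn_ege1 // ltW.
have n_gap : n%:R * (a - b) <= n%:R * (a - b) * b ^+ n.
  by rewrite ler_peMr // mulr_ge0 // subr_ge0.
have := ler_wpM2l (ltW A_gt0) (le_trans n_gap main).
have := ler_wpM2l b_ge0 gap.
lra.
Qed.

End Determination.

Theorem theorem3p6 (R : realType) (alpha eps : R)
    (alpha_neq0 : alpha != 0) (eps_gt0 : 0 < eps) :
  countable (chi eps alpha `&` `]1, 1 / (2 * eps) - 1[).
Proof.
(* The countably many sets [S (N, k)] cover the set in question, and each has at most one
   element. *)
pose S (Nk : nat * int) := [set zeta : R | [/\ 1 < zeta, (0 < Nk.1)%N,
  late_rank R eps Nk.1 zeta, near_int_from R alpha eps Nk.1 zeta
  & `|alpha * zeta ^+ Nk.1 - Nk.2%:~R| <= eps]].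
apply: (@sub_countable _ _ _ (\bigcup_Nk S Nk)).
  apply: subset_card_le => zeta [[zeta_gt1 [n0 dist_le]]] /=.
  rewrite in_itv /= => /andP[_ zeta_lt].
  have [N1 late] := late_rank_exists _ _ _ eps_gt0 zeta_gt1 zeta_lt.
  (* The absolute value handles a negative [n0]; the successor makes [N] positive. *)
  pose N := (N1 + `|n0|).+1.
  have near : near_int_from R alpha eps N zeta.
    move=> n n_ge; have [k k_near] := dist_int_attained R (alpha * zeta ^+ n).
    exists k; apply: le_trans k_near _; apply: (dist_le n%:Z).
    by rewrite /N in n_ge; lia.
  have [k k_near] := near N (leqnn N).
  exists (N, k) => //; split=> // n n_ge; apply: late.
  by rewrite /N /= in n_ge; lia.
apply: bigcup_countable => // -[N k] _.
apply: finite_set_countable.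
have [->|/set0P[a Sa]] := eqVneq (S (N, k)) set0; first exact: finite_set0.
apply: (@sub_finite_set _ _ [set a]); last exact: finite_set1.
move=> b; case: Sa => /= a_gt1 N_gt0 late_a near_a ka.
move=> [/= b_gt1 _ late_b near_b kb].
(* [near_int_unique] expects the larger base first. *)
have [b_le|/ltW a_le] := leP b a.
- by apply/esym; exact: (near_int_unique R alpha eps a b N k).
- exact: (near_int_unique R alpha eps b a N k).
Qed.
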